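(* Consider the stable dynamics model, an equilibrium $(f^*,t^* )$ and $R=\|t^*-\bar t\|_2$. Let $\varepsilon>0$ and let the universal gradient method (UGM) be run with accuracy $\varepsilon$ and initial parameter $0<L_0\le \frac{M^2}{\varepsilon}$, producing $\hat t^N,\hat f^N$. Then after at most $$N_Q = 2\left(\frac{RM}{\varepsilon}\right)^2$$ iterations of UGM it holds that $Q(\hat t^N)-Q(t^* )\le\varepsilon$. Moreover, let $g\in\{\Theta x: x\in X\}$ be such that $\xi = 1-\max_{e\in E} g_e/\bar f_e>0$, and let $\pi$ be the associated map to admissible flows. Then the stopping criterion $$Q(\hat t^N)+\Psi(\pi(\hat f^N))\le\varepsilon$$ is fulfilled after at most $$N_{stop}=O\left(\left(\frac{RM}{\varepsilon}\right)^2\max\left\{1,\ \left(\frac{\langle g-f^*,\bar t\rangle}{\xi R\min_{e}\bar f_e}\right)^2\right\}\right)$$ iterations, where $O(\cdot)$ hides an absolute constant (for this second bound $R>0$, so that the expression is defined).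
   Context: Network. $G=(V,E)$ is a finite directed graph. $OD$ is a finite set of origin-destination pairs $w=(i,j)$ of vertices, with demands $d_w\ge 0$. $P_w$ is the (nonempty) set of simple paths from $i$ to $j$ for $w=(i,j)$, and $P=\bigcup_{w\in OD}P_w$. $X=\{x\in\mathbb R_+^{|P|}:\sum_{p\in P_w}x_p=d_w,\ w\in OD\}$. $\Theta$ is the $|E|\times|P|$ matrix with $\Theta_{e,p}=1$ if $e\in p$ and $0$ otherwise. Each edge $e$ has free flow time $\bar t_e>0$ and capacity $\bar f_e>0$. For $t\in\mathbb R_+^{|E|}$: $T_p(t)=\sum_{e\in p}t_e$, $T_w(t)=\min_{p\in P_w}T_p(t)$. Vector inequalities are componentwise. Stable dynamics model. $\Phi(t)=-\sum_{w\in OD}d_wT_w(t)$, $h(t)=\langle t-\bar t,\bar f\rangle$ with $\operatorname{dom}h=\{t: t\ge\bar t\}$, and $Q(t)=\Phi(t)+h(t)$ is to be minimized over $t\ge\bar t$ (dual problem). The primal objective is $\Psi(f)=\sum_{e\in E}f_e\bar t_e$, to be minimized over $f\in\{\Theta x:x\in X\}$ with $f\le\bar f$. An equilibrium $(f^*,t^* )$ (assumed to exist) is a solution of the saddle-point problem $\min_{f\in\{\Theta x:x\in X\}}\max_{t\ge\bar t}\sum_{e\in E}[t_ef_e-(t_e-\bar t_e)\bar f_e]$; in particular $t^*$ minimizes $Q$ and $f^*$ solves the primal problem. Subgradients. $\partial\Phi(t)=-\sum_{w\in OD}d_w\,\mathrm{Conv}\{a_p:p\in P_w,\ T_p(t)=T_w(t)\}$,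 where $a_p\in\{0,1\}^{|E|}$ is the indicator vector of the edges of $p$. $\nabla\Phi(t)$ denotes an arbitrary (chosen) element of $\partial\Phi(t)$. Constant $M$. $M=\sqrt{2H}\sum_{w\in OD}d_w$, where $H$ is the diameter of $G$; $M$ comes with the bound $\|\nabla\Phi(t_1)-\nabla\Phi(t_2)\|_2\le M$ for all $t_1,t_2\in\mathbb R_+^{|E|}$ and all choices of subgradients. UGM. Input $L_0>0$, $\varepsilon>0$. Set $t^0=\bar t$. For $k=0,1,2,\dots$: set $L_{k+1}:=L_k/2$; repeat: compute $t^{k+1}:=\arg\min_{t\in\operatorname{dom}h}\{\langle\nabla\Phi(t^k),t-t^k\rangle+h(t)+\frac{L_{k+1}}2\|t-t^k\|_2^2\}$; if $\Phi(t^{k+1})\le\Phi(t^k)+\langle\nabla\Phi(t^k),t^{k+1}-t^k\rangle+\frac{L_{k+1}}2\|t^{k+1}-t^k\|_2^2+\frac\varepsilon2$, accept $L_{k+1},t^{k+1}$ and go to the next $k$; otherwise replace $L_{k+1}$ by $2L_{k+1}$ and repeat. ''Iterations'' counts the outer index $k$. After $N\ge1$ iterations, $$S_N=\sum_{k=1}^N\frac1{L_k},\quad \hat t^N=\frac1{S_N}\sum_{k=1}^N\frac{t^k}{L_k},\quad \hat f^N=-\frac1{S_N}\sum_{k=0}^{N-1}\frac{\nabla\Phi(t^k)}{L_{k+1}}.$$ Map $\pi$. Given $g$ and $\xi$ as in the claim, for $f\in\{\Theta x:x\in X\}$ let $\eta=\max_{e\in E}f_e/\bar f_e-1$; then $\pi(f)=f$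 if $\eta\le0$ and $\pi(f)=\frac{\xi f+\eta g}{\xi+\eta}$ if $\eta>0$. Convention: a property ''holds after at most $K$ iterations'' means that it holds for some integer $N$ with $1\le N\le\max\{1,\lceil K\rceil\}$. *)

(* Defs.v *)
From HB Require Import structures.
From mathcomp Require Import all_boot all_order all_algebra.
From mathcomp Require Import reals.

Set Implicit Arguments.
Unset Strict Implicit.
Unset Printing Implicit Defensive.

Import Order.TTheory GRing.Theory Num.Theory.
Local Open Scope ring_scope.

(* Minimum and maximum of u over A; the default x0 is returned only when A is
   empty. *)
Definition minval {disp} {T : orderType disp} {I : finType}
    (x0 : T) (A : {set I}) (u : I -> T) : T :=
  if [pick i in A] is Some i0 then u [arg min_(i < i0 in A) u i]%O else x0.

Definition maxval {disp} {T : orderType disp} {I : finType}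
    (x0 : T) (A : {set I}) (u : I -> T) : T :=
  if [pick i in A] is Some i0 then u [arg max_(i > i0 in A) u i]%O else x0.

Section Vectors.
Context {R : realType} {I : finType}.
Implicit Types u v : {ffun I -> R}.

Definition vle u v : Prop := forall i, u i <= v i.

Definition dot u v : R := \sum_i u i * v i.

Definition norm2 u : R := Num.sqrt (\sum_i u i ^+ 2).

(* Convex hull of the finite family (a j), j in J. *)
Definition conv {K : finType} (J : {set K}) (a : K -> {ffun I -> R}) v : Prop :=
  exists l : K -> R,
    [/\ forall j, j \in J -> 0 <= l j,
        \sum_(j in J) l j = 1 &
        v = [ffun i => \sum_(j in J) l j * a j i]].

End Vectors.

(* Finite directed graph; parallel edges and loops are allowed. *)
Record digraph := Digraph {
  vertex : finType;
  edge : finType;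
  src : edge -> vertex;
  tgt : edge -> vertex }.

Section Paths.
Variable G : digraph.

(* A path is a start vertex together with its list of edges: the start vertex
   distinguishes the empty paths at different vertices. A simple path has
   fewer than #|V| edges, so that the bound on the length is harmless. *)
Definition gpath : finType := (vertex G * #|vertex G|.-bseq (edge G))%type.

Definition edges (p : gpath) : seq (edge G) := p.2.

Definition vertices (p : gpath) : seq (vertex G) :=
  p.1 :: [seq tgt e | e <- edges p].

(* p is a simple path from w.1 to w.2; the second conjunct says that each edge
   of p starts at the vertex reached so far. *)
Definition simple_path (w : vertex G * vertex G) (p : gpath) : bool :=
  [&& p.1 == w.1,
      [seq src e | e <- edges p] == belast p.1 [seq tgt e | e <- edges p],
      last p.1 [seq tgt e | e <- edges p] == w.2 &
      uniq (vertices p)].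

Definition paths (w : vertex G * vertex G) : {set gpath} :=
  [set p | simple_path w p].

(* Number of edges of a shortest path from w.1 to w.2 (0 if there is none). *)
Definition distance (w : vertex G * vertex G) : nat :=
  minval 0%N (paths w) (fun p => size (edges p)).

(* Largest distance between two vertices, the second being reachable from the
   first. *)
Definition diameter : nat := \max_(w : vertex G * vertex G) distance w.

End Paths.

Record network (R : realType) := Network {
  graph :> digraph;
  OD : {set vertex graph * vertex graph};
  demand : vertex graph * vertex graph -> R;
  tbar : {ffun edge graph -> R};
  fbar : {ffun edge graph -> R};
  demand_ge0 : forall w, w \in OD -> 0 <= demand w;
  paths_neq0 : forall w, w \in OD -> paths w != set0;
  tbar_gt0 : forall e, 0 < tbar e;
  fbar_gt0 : forall e, 0 < fbar e }.

Arguments demand {R} n w.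

Section Model.
Context {R : realType}.
Variable G : network R.

Notation vec := {ffun edge G -> R}.
Implicit Types f g s t : vec.

Definition all_paths : {set gpath G} := \bigcup_(w in OD G) paths w.

(* The index set P of path flows, as a type. *)
Definition odpath : finType := {p : gpath G | p \in all_paths}.

Definition path_flow (x : {ffun odpath -> R}) : Prop :=
  (forall p, 0 <= x p) /\
  (forall w, w \in OD G -> \sum_(p | val p \in paths w) x p = demand G w).

Definition Theta (e : edge G) (p : odpath) : R := (e \in edges (val p))%:R.

(* The set {Theta x : x in X}. *)
Definition flow f : Prop :=
  exists x : {ffun odpath -> R},
    path_flow x /\ f = [ffun e => \sum_p Theta e p * x p].

Definition Tpath (p : gpath G) t : R := \sum_(e | e \in edges p) t e.

Definition Tod (w : vertex G * vertex G) t : R :=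
  minval 0 (paths w) (fun p => Tpath p t).

Definition Phi t : R := - \sum_(w in OD G) demand G w * Tod w t.

Definition dom_h t : Prop := vle (tbar G) t.

(* The function h on its domain. *)
Definition h t : R := dot (t - tbar G) (fbar G).

Definition Q t : R := Phi t + h t.

Definition Psi f : R := \sum_e f e * tbar G e.

Definition lagrangian f t : R :=
  \sum_e (t e * f e - (t e - tbar G e) * fbar G e).

Definition equilibrium f t : Prop :=
  [/\ flow f, dom_h t,
      (forall t', dom_h t' -> lagrangian f t' <= lagrangian f t) &
      (forall f', flow f' -> lagrangian f t <= lagrangian f' t)].

Definition indic (p : gpath G) : vec := [ffun e => (e \in edges p)%:R].

Definition shortest (w : vertex G * vertex G) t : {set gpath G} :=
  [set p in paths w | Tpath p t == Tod w t].

(* The subdifferential of Phi at t. *)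
Definition subdiff_Phi t s : Prop :=
  exists c : vertex G * vertex G -> vec,
    (forall w, w \in OD G -> conv (shortest w t) indic (c w)) /\
    s = [ffun e => - \sum_(w in OD G) demand G w * c w e].

Definition Mconst : R :=
  Num.sqrt (2 * (diameter G)%:R) * \sum_(w in OD G) demand G w.

Definition Mbound : Prop :=
  forall t1 t2 s1 s2, vle 0 t1 -> vle 0 t2 ->
    subdiff_Phi t1 s1 -> subdiff_Phi t2 s2 -> norm2 (s1 - s2) <= Mconst.

Section UGM.
Variables (gradPhi : vec -> vec) (eps : R).

Definition subgradient_choice : Prop :=
  forall t, vle 0 t -> subdiff_Phi t (gradPhi t).

Definition prox_obj t L t' : R :=
  dot (gradPhi t) (t' - t) + h t' + L / 2 * norm2 (t' - t) ^+ 2.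

Definition prox_argmin t L t' : Prop :=
  dom_h t' /\ forall u, dom_h u -> prox_obj t L t' <= prox_obj t L u.

Definition accepted t L t' : Prop :=
  Phi t' <= Phi t + dot (gradPhi t) (t' - t)
            + L / 2 * norm2 (t' - t) ^+ 2 + eps / 2.

(* linesearch t L L' t': the inner loop at the point t, entered with the trial
   value L, terminates and returns the constant L' and the point t'. *)
Inductive linesearch t (L : R) : R -> vec -> Prop :=
| LS_accept t' : prox_argmin t L t' -> accepted t L t' -> linesearch t L L t'
| LS_reject t' L'' t'' : prox_argmin t L t' -> ~ accepted t L t' ->
    linesearch t (2 * L) L'' t'' -> linesearch t L L'' t''.

Definition UGM_run (L0 : R) (L : nat -> R) (t : nat -> vec) : Prop :=
  [/\ L 0%N = L0, t 0%N = tbar G &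
      forall k, linesearch (t k) (L k / 2) (L k.+1) (t k.+1)].

Definition Ssum (L : nat -> R) (N : nat) : R :=
  \sum_(1 <= k < N.+1) (L k)^-1.

Definition that (L : nat -> R) (t : nat -> vec) (N : nat) : vec :=
  [ffun e => (Ssum L N)^-1 * \sum_(1 <= k < N.+1) t k e / L k].

Definition fhat (L : nat -> R) (t : nat -> vec) (N : nat) : vec :=
  [ffun e => - ((Ssum L N)^-1 *
                \sum_(0 <= k < N) gradPhi (t k) e / L k.+1)].

End UGM.

Definition max_load f : R := maxval 0 [set: edge G] (fun e => f e / fbar G e).

Definition min_capacity : R := minval 0 [set: edge G] (fbar G).

Definition slack g : R := 1 - max_load g.

Definition to_admissible g f : vec :=
  let xi := slack g in
  let eta := max_load f - 1 in
  if eta <= 0 then f else [ffun e => (xi * f e + eta * g e) / (xi + eta)].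

End Model.

(* P holds after at most K iterations. *)
Definition within_iters {R : realType} (K : R) (P : nat -> Prop) : Prop :=
  exists N : nat,
    [/\ (1 <= N)%N, (N%:Z <= Num.max 1 (Num.ceil K))%R & P N].

(* Main.v *)
Require Import Defs.
From mathcomp Require Import all_boot all_order all_algebra.
From mathcomp Require Import boolp reals.
From mathcomp Require Import ring lra.

Import Order.TTheory GRing.Theory Num.Theory.
Local Open Scope ring_scope.

(** Write g_k for the chosen subgradient at t^k. Since Phi is positively
    homogeneous, <g_k, t^k> = Phi(t^k), and -g_k is a flow; hence so is the
    average fhat. Adding up the prox inequalities, weighted by 1 / L_k, gives
    for every u >= tbar
      Q(that) <= eps / 2 - <fhat, u> + h(u) + |u - tbar|^2 / (2 S_N),
    where S_N >= N eps / (2 M^2) because the line search accepts every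
    L >= M^2 / eps. The first bound is the case u = tstar, because
    -<fhat, tstar> <= Phi(tstar).

    For the second, put p = (fhat - fbar)_+. Taking u = tbar + S_N p yields
      Q(that) + Psi(fhat) <= eps / 2 - S_N |p|^2 / 2.
    The map pi moves fhat towards g by a step of relative size eta / (xi + eta)
    <= |p| / (xi min fbar), and the saddle point property gives
    Psi(fhat) >= Psi(fstar) - <tstar - tbar, p>. So passing to pi(fhat) costs
    an amount linear in |p|, which the quadratic term absorbs once
    S_N >= 2 (R^2 + (<g - fstar, tbar> / (xi min fbar))^2) / eps. *)

(** * Extrema over nonempty finite sets *)

Lemma minvalP {disp} {T : orderType disp} {I : finType}
    (x0 : T) (A : {set I}) (u : I -> T) : A != set0 ->
  exists2 i, i \in A &
    minval x0 A u = u i /\ forall j, j \in A -> (u i <= u j)%O.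
Proof.
case/set0Pn => i0 Ai0; rewrite /minval.
case: pickP => [i Ai | /(_ i0)]; last by rewrite Ai0.
by case: arg_minP => // j Aj min_j; exists j.
Qed.

Lemma maxvalP {disp} {T : orderType disp} {I : finType}
    (x0 : T) (A : {set I}) (u : I -> T) : A != set0 ->
  exists2 i, i \in A &
    maxval x0 A u = u i /\ forall j, j \in A -> (u j <= u i)%O.
Proof.
case/set0Pn => i0 Ai0; rewrite /maxval.
case: pickP => [i Ai | /(_ i0)]; last by rewrite Ai0.
by case: arg_maxP => // j Aj max_j; exists j.
Qed.

(** * Inner products and two elementary inequalities *)

Section Dot.
Context {R : realType} {I : finType}.
Implicit Types (u v w : {ffun I -> R}) (a : R).

Lemma dotC u v : dot u v = dot v u.
Proof. by apply: eq_bigr => i _; rewrite mulrC. Qed.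

Lemma dotDl u v w : dot (u + v) w = dot u w + dot v w.
Proof. by rewrite -big_split; apply: eq_bigr => i _; rewrite ffunE mulrDl. Qed.

Definition scalev a u : {ffun I -> R} := [ffun i => a * u i].

Lemma dotZl a u w : dot (scalev a u) w = a * dot u w.
Proof. by rewrite mulr_sumr; apply: eq_bigr => i _; rewrite ffunE mulrA. Qed.

Lemma dotDr u v w : dot w (u + v) = dot w u + dot w v.
Proof. by rewrite dotC dotDl !(dotC w). Qed.

Lemma dotZr a u w : dot w (scalev a u) = a * dot w u.
Proof. by rewrite dotC dotZl (dotC w). Qed.

Lemma dotNl u w : dot (- u) w = - dot u w.
Proof. by rewrite -sumrN; apply: eq_bigr => i _; rewrite ffunE mulNr. Qed.

Lemma dotNr u w : dot w (- u) = - dot w u.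
Proof. by rewrite dotC dotNl dotC. Qed.

Definition dotE := (dotDl, dotDr, dotNl, dotNr, dotZl, dotZr).

Lemma dot_ge0 u : 0 <= dot u u.
Proof. by apply: sumr_ge0 => i _; rewrite -expr2 sqr_ge0. Qed.

Lemma norm2_sqr u : norm2 u ^+ 2 = dot u u.
Proof.
rewrite sqr_sqrtr; first by apply: eq_bigr => i _; rewrite expr2.
by apply: sumr_ge0 => i _; rewrite sqr_ge0.
Qed.

(** Young's inequality, by expanding a/2 |u/a - v|^2 >= 0. *)
Lemma dot_amgm u v a : 0 < a ->
  dot u v <= dot u u / (2 * a) + a / 2 * dot v v.
Proof.
move=> a0; have := dot_ge0 (scalev a^-1 u - v).
rewrite !dotE (dotC v u) => H.
have {}H : 0 <= a / 2 * (a^-1 * (a^-1 * dot u u) - a^-1 * dot u v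
                  - (a^-1 * dot u v - dot v v)).
  by apply: mulr_ge0; [rewrite divr_ge0 // ltW | move: H; lra].
rewrite -subr_ge0; apply: etrans H; congr (_ <= _); field.
by rewrite gt_eqF.
Qed.

Lemma dot_wsum (c : R) m n (b : nat -> R) (F : nat -> {ffun I -> R}) w :
  dot [ffun i => c * \sum_(m <= k < n) F k i * b k] w
  = c * \sum_(m <= k < n) dot (F k) w * b k.
Proof.
rewrite /dot; under eq_bigr do rewrite ffunE -mulrA mulr_suml.
rewrite -mulr_sumr exchange_big; congr (_ * _); apply: eq_bigr => k _.
by rewrite mulr_suml; apply: eq_bigr => i _; rewrite mulrAC.
Qed.

End Dot.

(** First-order optimality without a limit: if a < 0, the admissible choice s = -a / (b - a) gives
    the negative value a^3 / (b - a)^2. *)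
Lemma linear_coef_ge0 {R : realFieldType} (a b : R) : 0 <= b ->
  (forall s, 0 < s <= 1 -> 0 <= s * a + s ^+ 2 * b) -> 0 <= a.
Proof.
move=> b0 H; rewrite leNgt; apply/negP => a0.
have ba : 0 < b - a by lra.
have /H : 0 < - a / (b - a) <= 1.
  by rewrite divr_gt0 ?oppr_gt0 //= ler_pdivrMr // mul1r; lra.
have -> : - a / (b - a) * a + (- a / (b - a)) ^+ 2 * b
        = a ^+ 3 / (b - a) ^+ 2 by field; rewrite gt_eqF.
rewrite leNgt pmulr_llt0 ?invr_gt0 ?exprn_gt0 //.
by rewrite exprS pmulr_llt0 ?a0 // exprn_even_gt0 //= lt_eqF.
Qed.

(** * Path flows and the subgradients of [Phi] *)

Section Model.
Context {R : realType} {G : network R}.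
Implicit Types (f g s t u : {ffun edge G -> R}) (p : gpath G).

(** A path determines its pair of end points, so the sets [paths w] are disjoint and a sum over all
    paths splits by pairs without double counting. *)
Definition ends p : vertex G * vertex G :=
  (p.1, last p.1 [seq tgt e | e <- edges p]).

Lemma ends_path w p : p \in paths w -> ends p = w.
Proof.
by rewrite inE /ends; case/and4P => /eqP -> _ /eqP -> _; case: w.
Qed.

Lemma odpath_ends (p : odpath G) : ends (val p) \in OD G.
Proof. by case/bigcupP: (valP p) => w ODw /ends_path ->. Qed.

Lemma mem_odpaths (p : odpath G) w : (val p \in paths w) = (ends (val p) == w).
Proof.
apply/idP/eqP => [/ends_path // | <-].
by case/bigcupP: (valP p) => w' _ pw'; rewrite (ends_path _ _ pw').
Qed.

Lemma sum_odpath (F : odpath G -> R) :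
  \sum_p F p = \sum_(w in OD G) \sum_(p | val p \in paths w) F p.
Proof.
rewrite (partition_big (fun p : odpath G => ends (val p)) (mem (OD G))) /=.
  by apply: eq_bigr => w _; apply: eq_bigl => p; rewrite mem_odpaths.
by move=> p _; apply: odpath_ends.
Qed.

Lemma sum_val_odpath w (F : gpath G -> R) : w \in OD G ->
  \sum_(p : odpath G | val p \in paths w) F (val p)
  = \sum_(p in paths w) F p.
Proof.
move=> ODw.
rewrite -(big_sub_cond (mem (all_paths G)) (mem (paths w))) /=.
apply: eq_bigl => p; rewrite andb_idl // => pw.
by apply/bigcupP; exists w.
Qed.

Lemma Tpath_dot p t : Tpath p t = dot (indic p) t.
Proof.
rewrite /Tpath big_mkcond; apply: eq_bigr => e _.
by rewrite ffunE; case: (e \in _); rewrite ?mul1r ?mul0r.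
Qed.

Lemma Tod_le w p t : p \in paths w -> Tod w t <= Tpath p t.
Proof.
move=> pw; have /(minvalP 0 _ (fun p => Tpath p t)) : paths w != set0.
  by apply/set0Pn; exists p.
case=> q _ [Tq le_q]; have -> : Tod w t = Tpath q t by exact: Tq.
exact: le_q.
Qed.

(** Every path that carries flow costs at least the shortest length of its pair. *)
Lemma flow_dot_Phi f t : flow f -> - dot f t <= Phi t.
Proof.
case=> x [[x0 xd] ->]; rewrite lerN2 /dot.
under [leRHS]eq_bigr => e _ do rewrite ffunE mulr_suml.
rewrite exchange_big sum_odpath /=; apply: ler_sum => w ODw.
rewrite -(xd w ODw) mulr_suml; apply: ler_sum => p pw.
apply: le_trans (ler_wpM2l (x0 p) (Tod_le _ _ t pw)) _.
rewrite Tpath_dot /dot mulr_sumr; apply: ler_sum => e _.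
by rewrite ffunE /Theta mulrCA mulrA.
Qed.

(** Euler's identity: the convex weights sit on shortest paths only, all of length [Tod w t], and
    sum to 1. *)
Lemma subdiff_dot_Phi t s : subdiff_Phi t s -> dot s t = Phi t.
Proof.
case=> c [cP ->]; rewrite /dot /Phi.
under eq_bigr => e _ do rewrite ffunE mulNr mulr_suml.
rewrite sumrN exchange_big; congr (- _); apply: eq_bigr => w ODw /=.
under eq_bigr => e _ do rewrite -mulrA.
rewrite -mulr_sumr; congr (_ * _).
have [l [_ l1 ->]] := cP w ODw.
under eq_bigr => e _ do rewrite ffunE mulr_suml.
rewrite exchange_big -[RHS]mul1r -l1 mulr_suml /=.
apply: eq_bigr => p; rewrite inE => /andP[_ /eqP <-].
rewrite Tpath_dot /dot mulr_sumr; apply: eq_bigr => e _.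
by rewrite mulrA.
Qed.

(** The convex weights of each pair, scaled by its demand, form a path flow. *)
Lemma subdiff_flow t s : subdiff_Phi t s -> flow (- s).
Proof.
case=> c [cP ->].
have /choice[l lP] : forall w, exists l : gpath G -> R, w \in OD G ->
    [/\ forall p, p \in shortest w t -> 0 <= l p,
        \sum_(p in shortest w t) l p = 1 &
        c w = [ffun e => \sum_(p in shortest w t) l p * indic p e]].
  move=> w; case: (boolP (w \in OD G)) => [ODw | _]; last by exists (fun=> 0).
  by case: (cP w ODw) => l lP; exists l.
(* The weights are constrained on shortest paths only, hence the cut-off to 0 elsewhere. *)
pose y w p := demand G w * (if p \in shortest w t then l w p else 0).
pose x := [ffun p : odpath G => y (ends (val p)) (val p)].
have sum_y w (F : gpath G -> R) : w \in OD G ->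
  \sum_(p : odpath G | val p \in paths w) F (val p) * x p
  = demand G w * \sum_(p in shortest w t) l w p * F p.
  move=> ODw; under eq_bigr => p pw do rewrite ffunE (ends_path _ _ pw).
  rewrite (sum_val_odpath w (fun p => F p * y w p)) //.
  rewrite mulr_sumr [RHS]big_mkcond [LHS]big_mkcond; apply: eq_bigr => p _.
  rewrite /y !inE; case: (simple_path w p) => //=; case: eqP => _; first ring.
  by rewrite !mulr0.
exists x; split; first split.
- move=> p; rewrite ffunE /y mulr_ge0 ?demand_ge0 ?odpath_ends //.
  by case: ifP => // pS; have [+ _ _] := lP _ (odpath_ends p); apply.
- move=> w ODw; have := sum_y w (fun=> 1) ODw.
  under eq_bigr do rewrite mul1r; move=> ->.
  under eq_bigr do rewrite mulr1; have [_ -> _] := lP w ODw.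
  by rewrite mulr1.
- apply/ffunP => e; rewrite !ffunE opprK sum_odpath; apply: eq_bigr => w ODw.
  have [_ _ ->] := lP w ODw; rewrite ffunE.
  have := sum_y w (fun p => (e \in edges p)%:R) ODw.
  rewrite /Theta => ->; congr (_ * _); apply: eq_bigr => p _.
  by rewrite ffunE.
Qed.

Lemma flow_convex N (a : nat -> R) (F : nat -> {ffun edge G -> R}) :
  (forall k, 0 <= a k) -> \sum_(0 <= k < N) a k = 1 ->
  (forall k, flow (F k)) -> flow [ffun e => \sum_(0 <= k < N) a k * F k e].
Proof.
move=> a0 a1 /choice[x xP].
exists [ffun p => \sum_(0 <= k < N) a k * x k p]; split; first split.
- move=> p; rewrite ffunE; apply: sumr_ge0 => k _; rewrite mulr_ge0 //.
  by have [[+ _] _] := xP k; apply.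
- move=> w ODw; under eq_bigr do rewrite ffunE.
  rewrite exchange_big -[RHS]mul1r -a1 mulr_suml; apply: eq_bigr => k _ /=.
  by rewrite -mulr_sumr; congr (_ * _); have [[_ +] _] := xP k; apply.
- apply/ffunP => e; rewrite !ffunE.
  under [RHS]eq_bigr do rewrite ffunE mulr_sumr.
  rewrite exchange_big; apply: eq_bigr => k _ /=.
  have [_ ->] := xP k; rewrite ffunE mulr_sumr; apply: eq_bigr => p _.
  exact: mulrCA.
Qed.

End Model.

(** * Analysis of the universal gradient method *)

Section UniversalGradient.
Context {R : realType} {G : network R}.
Variables (gradPhi : {ffun edge G -> R} -> {ffun edge G -> R}) (eps : R).
Hypotheses (MG : Mbound G) (gradP : subgradient_choice gradPhi).
Hypothesis eps_gt0 : 0 < eps.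
Implicit Types (f g s t u z : {ffun edge G -> R}) (l : R).

Lemma dom_h_ge0 t : dom_h t -> vle 0 t.
Proof. by move=> ht e; rewrite ffunE (le_trans (ltW (tbar_gt0 e))). Qed.

Lemma dot_gradPhi t : vle 0 t -> dot (gradPhi t) t = Phi t.
Proof. by move=> t0; apply: (subdiff_dot_Phi t); apply: gradP. Qed.

(** Together with [dot_gradPhi] this is the subgradient inequality at t. *)
Lemma dot_gradPhi_le t u : vle 0 t -> dot (gradPhi t) u <= Phi u.
Proof.
move=> t0; have := flow_dot_Phi _ u (subdiff_flow _ _ (gradP _ t0)).
by rewrite dotNl opprK.
Qed.

(** With g, g' the subgradients at t, t', the linearization error is at most <g' - g, t' - t>.
    Young's inequality bounds this by M^2 / (2 l) + l/2 |t' - t|^2, and the first term is at most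
    eps / 2. *)
Lemma accepted_large t t' l : vle 0 t -> vle 0 t' -> 0 < l ->
  Mconst G ^+ 2 / eps <= l -> accepted gradPhi eps t l t'.
Proof.
move=> t0 t'0 l0; rewrite ler_pdivrMr // /accepted norm2_sqr => lM.
rewrite -(dot_gradPhi t' t'0).
have le_t := dot_gradPhi_le t' t t'0.
have := dot_amgm (gradPhi t' - gradPhi t) (t' - t) l l0.
suff : dot (gradPhi t' - gradPhi t) (gradPhi t' - gradPhi t) / (2 * l)
       <= eps / 2 by rewrite !dotE; lra.
rewrite ler_pdivrMr ?mulr_gt0 // -norm2_sqr.
rewrite (_ : eps / 2 * (2 * l) = l * eps); last by field.
apply: le_trans lM; rewrite lerXn2r ?nnegrE ?sqrtr_ge0 //; last first.
  exact: MG _ _ (gradP _ t'0) (gradP _ t0).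
(* [Mconst G] is nonnegative because it bounds a norm. *)
apply: le_trans (MG _ _ _ _ t0 t0 (gradP _ t0) (gradP _ t0)).
exact: sqrtr_ge0.
Qed.

(** By [accepted_large] a rejected value is at most M^2 / eps, so its double respects the bound;
    induction on the inner loop preserves this. *)
Lemma linesearchP t l l' t' : vle 0 t -> 0 < l ->
  l <= 2 * (Mconst G ^+ 2 / eps) -> linesearch gradPhi eps t l l' t' ->
  [/\ 0 < l', l' <= 2 * (Mconst G ^+ 2 / eps),
      prox_argmin gradPhi t l' t' & accepted gradPhi eps t l' t'].
Proof.
move=> t0 l0 lM ls; elim: ls l0 lM => {l l' t'} [l t' | l t' l' t''] //.
move=> [ht' _] rej _ IH l0 _; apply: IH; first by rewrite mulr_gt0.
rewrite ler_pM2l // leNgt; apply/negP => Ml; apply: rej.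
by apply: accepted_large (ltW Ml) => //; apply: dom_h_ge0.
Qed.

(** Strong convexity: along the segment from z to u the objective is a quadratic polynomial, and
    minimality at z forces its linear coefficient to be nonnegative. *)
Lemma prox_argmin_gap t l z u : 0 < l -> prox_argmin gradPhi t l z ->
  dom_h u ->
  prox_obj gradPhi t l z + l / 2 * dot (u - z) (u - z)
  <= prox_obj gradPhi t l u.
Proof.
move=> l0 [hz min_z] hu; set d := u - z.
(* The derivative of the prox objective at z in the direction d. *)
pose a := dot (gradPhi t) d + dot d (fbar G) + l * dot (z - t) d.
have prox_line (b : R) : prox_obj gradPhi t l (z + scalev b d)
    = prox_obj gradPhi t l z + b * a + b ^+ 2 * (l / 2 * dot d d).
  rewrite /prox_obj !norm2_sqr /h /a.
  have E v : z + scalev b d - v = (z - v) + scalev b d by rewrite addrAC.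
  rewrite !E !(dotDl _ (scalev b d)) !(dotDr _ (scalev b d)) !(dotZl, dotZr).
  by rewrite (dotC d (z - t)); field.
have u_line : u = z + scalev 1 d.
  by apply/ffunP => e; rewrite !ffunE mul1r addrC subrK.
rewrite u_line prox_line expr1n !mul1r lerD2r lerDl.
apply: (@linear_coef_ge0 _ a (l / 2 * dot d d)) => [|b /andP[b0 b1]].
  by rewrite mulr_ge0 ?dot_ge0 ?divr_ge0 ?ltW.
rewrite -[leRHS](addrK (prox_obj gradPhi t l z)) subr_ge0.
rewrite addrC addrA -prox_line; apply: min_z => e; rewrite !ffunE.
rewrite -subr_ge0 (_ : _ - _ = (1 - b) * (z e - tbar G e)
                              + b * (u e - tbar G e)); last by ring.
by rewrite addr_ge0 // mulr_ge0 ?subr_ge0 ?hz ?hu // ltW.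
Qed.

Variables (L0 : R) (L : nat -> R) (t : nat -> {ffun edge G -> R}).
Hypothesis L0P : 0 < L0 <= Mconst G ^+ 2 / eps.
Hypothesis run : UGM_run gradPhi eps L0 L t.

Let Lmax := 2 * (Mconst G ^+ 2 / eps).
Let S := Ssum L.

Lemma Lmax_gt0 : 0 < Lmax.
Proof. by case/andP: L0P => a b; rewrite mulr_gt0 // (lt_le_trans a). Qed.

Lemma UGM_bounds k : [/\ dom_h (t k), 0 < L k & L k <= Lmax].
Proof.
have [L_0 t_0 step] := run; elim: k => [|k [tk Lk0 LkM]].
  rewrite t_0 L_0; split => [e | |]; first exact: lexx.
    by case/andP: L0P.
  have := Lmax_gt0; case/andP: L0P; rewrite /Lmax; lra.
have tk0 := dom_h_ge0 _ tk.
have [|| L0' LM [ht _] _] := linesearchP _ _ _ _ tk0 _ _ (step k) => //.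
  by rewrite divr_gt0.
by move: LkM; rewrite /Lmax; lra.
Qed.

Lemma dom_h_UGM k : dom_h (t k). Proof. by case: (UGM_bounds k). Qed.
Lemma UGM_ge0 k : vle 0 (t k). Proof. exact: dom_h_ge0 (dom_h_UGM k). Qed.
Lemma L_gt0 k : 0 < L k. Proof. by case: (UGM_bounds k). Qed.
Lemma L_le k : L k <= Lmax. Proof. by case: (UGM_bounds k). Qed.

(** Acceptance bounds [Phi] at the new point, and [prox_argmin_gap] compares that point with u;
    [Phi (t k)] cancels against <g_k, t^k>. Dividing by L_{k+1} gives the squared distances the
    constant factor 1/2, so that they telescope. *)
Lemma UGM_step k u : dom_h u ->
  (Q (t k.+1) - eps / 2) / L k.+1 + dot (u - t k.+1) (u - t k.+1) / 2
  <= (dot (gradPhi (t k)) u + h u) / L k.+1 + dot (u - t k) (u - t k) / 2.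
Proof.
move=> hu; have [_ _ step] := run.
have [|| _ _ argm acc] := linesearchP _ _ _ _ (UGM_ge0 k) _ _ (step k).
- by rewrite divr_gt0 ?L_gt0.
- by have := L_le k; have := L_gt0 k; rewrite /Lmax; lra.
have := prox_argmin_gap _ _ _ _ (L_gt0 k.+1) argm hu.
move: acc; rewrite /accepted /prox_obj !norm2_sqr -(dot_gradPhi _ (UGM_ge0 k)).
rewrite !(dotDr _ _ (gradPhi _)) !(dotNr _ (gradPhi _)) /Q.
have := L_gt0 k.+1; move: (L k.+1) => l l0 acc gap.
rewrite -(ler_pM2l l0) !mulrDr !(mulrCA l) !divff ?gt_eqF // !mulr1.
by move: acc gap; lra.
Qed.

Lemma UGM_telescope N u : dom_h u ->
  \sum_(0 <= k < N) (Q (t k.+1) - eps / 2) / L k.+1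
    + dot (u - t N) (u - t N) / 2
  <= \sum_(0 <= k < N) (dot (gradPhi (t k)) u + h u) / L k.+1
     + dot (u - tbar G) (u - tbar G) / 2.
Proof.
move=> hu; have [_ <- _] := run; elim: N => [|N IH].
  by rewrite !big_geq.
rewrite !big_nat_recr //=; have := UGM_step N u hu.
by move: IH; lra.
Qed.

Lemma SsumE N : S N = \sum_(0 <= k < N) (L k.+1)^-1.
Proof. by rewrite /S /Ssum big_add1. Qed.

Lemma Ssum_ge N : N%:R / Lmax <= S N.
Proof.
rewrite SsumE -[N in N%:R]subn0 mulr_natl -sumr_const_nat.
apply: ler_sum => k _.
by rewrite lef_pV2 ?posrE ?L_gt0 ?Lmax_gt0 ?L_le.
Qed.

(** Turns an iteration count into a lower bound on S_N, since eps N / [Lmax] = N / (2 (M /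
    eps)^2). *)
Lemma Ssum_large N (c : R) :
  2 * c * (Mconst G / eps) ^+ 2 <= N%:R -> c <= eps * S N.
Proof.
move=> cN; have M0 := Lmax_gt0; rewrite mulrC -ler_pdivrMr //.
apply: le_trans (Ssum_ge N); rewrite ler_pdivlMr //; apply: le_trans cN.
rewrite /Lmax le_eqVlt; apply/orP; left; apply/eqP; field.
by rewrite gt_eqF.
Qed.

Lemma Ssum_gt0 N : (0 < N)%N -> 0 < S N.
Proof.
move=> N0; apply: lt_le_trans (Ssum_ge N).
by rewrite divr_gt0 ?Lmax_gt0 ?ltr0n.
Qed.

Lemma dot_that N v : dot (that L t N) v
  = (S N)^-1 * \sum_(0 <= k < N) dot (t k.+1) v / L k.+1.
Proof.
by rewrite /that (dot_wsum _ _ _ (fun k => (L k)^-1) t) big_add1.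
Qed.

Lemma dot_fhat N v : dot (fhat gradPhi L t N) v
  = - ((S N)^-1 * \sum_(0 <= k < N) dot (gradPhi (t k)) v / L k.+1).
Proof.
rewrite -(dot_wsum _ _ _ (fun k => (L k.+1)^-1) (fun k => gradPhi (t k))).
by rewrite -dotNl; congr dot; apply/ffunP => e; rewrite !ffunE.
Qed.

Lemma dom_h_that N : (0 < N)%N -> dom_h (that L t N).
Proof.
move=> N0 e; rewrite ffunE ler_pdivlMl ?Ssum_gt0 // mulrC.
rewrite mulr_sumr; apply: ler_sum => k _.
by rewrite ler_pM2r ?invr_gt0 ?L_gt0 // dom_h_UGM.
Qed.

(** Jensen's inequality: the subgradient at the average is exact there and lies below [Phi] at every
    t^k, while [h] is affine. *)
Lemma Q_that_le N : (0 < N)%N ->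
  S N * Q (that L t N) <= \sum_(0 <= k < N) Q (t k.+1) / L k.+1.
Proof.
move=> N0; have that0 := dom_h_ge0 _ (dom_h_that N N0).
have SN0 : S N != 0 by rewrite gt_eqF ?Ssum_gt0.
rewrite /Q -(dot_gradPhi _ that0) /h dotDl dotNl (dotC (gradPhi _)) !dot_that.
set s := gradPhi _.
rewrite !mulrDr !mulVKf // (mulrC (S N)) SsumE mulr_sumr.
rewrite -!big_split /=; apply: ler_sum => k _.
rewrite -!mulrDl ler_pM2r ?invr_gt0 ?L_gt0 // dotDl dotNl.
have := dot_gradPhi_le _ (t k.+1) that0; rewrite -/s dotC; lra.
Qed.

Lemma Q_that_bound N u : (0 < N)%N -> dom_h u ->
  Q (that L t N) <= eps / 2 - dot (fhat gradPhi L t N) u + h u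
                    + dot (u - tbar G) (u - tbar G) / (2 * S N).
Proof.
move=> N0 hu; have S0 := Ssum_gt0 N N0.
rewrite -(ler_pM2l S0); apply: le_trans (Q_that_le N N0) _.
have := UGM_telescope N u hu; rewrite dot_fhat.
under eq_bigr do rewrite mulrBl; rewrite sumrB.
under [X in _ <= X + _ -> _]eq_bigr do rewrite mulrDl; rewrite big_split /=.
rewrite -!mulr_sumr -SsumE opprK !mulrDr mulVKf ?gt_eqF //.
have := dot_ge0 (u - t N); set d := dot (u - tbar G) _.
have -> : S N * (d / (2 * S N)) = d / 2 by field; rewrite gt_eqF.
by lra.
Qed.

(** A convex combination of the flows -g_k, with weights 1 / (S_N L_{k+1}). *)
Lemma flow_fhat N : (0 < N)%N -> flow (fhat gradPhi L t N).
Proof.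
move=> N0; have S0 := Ssum_gt0 N N0.
have -> : fhat gradPhi L t N = [ffun e => \sum_(0 <= k < N)
    ((S N)^-1 / L k.+1) * (- gradPhi (t k)) e].
  apply/ffunP => e; rewrite !ffunE mulr_sumr -sumrN; apply: eq_bigr => k _.
  by rewrite ffunE mulrN mulrA mulrAC.
apply: flow_convex => [k||k].
- by rewrite divr_ge0 ?invr_ge0 ?ltW ?L_gt0.
- by rewrite -mulr_sumr -SsumE mulVf ?gt_eqF.
- by apply: subdiff_flow; apply: gradP; apply: UGM_ge0.
Qed.

End UniversalGradient.

(** * Saddle point, capacity excess and the map to admissible flows *)

Section Duality.
Context {R : realType} {G : network R}.
Implicit Types (f g t u v : {ffun edge G -> R}).

Lemma Psi_dot f : Psi f = dot f (tbar G).
Proof. by []. Qed.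

Lemma lagrangianE f t :
  lagrangian f t = Psi f + dot (t - tbar G) (f - fbar G).
Proof.
rewrite /Psi /dot -big_split; apply: eq_bigr => e _; rewrite !ffunE /=.
ring.
Qed.

(** Both saddle point inequalities are chained: from (fs, tbar) to (fs, ts), then to (f, ts). *)
Lemma equilibrium_Psi_le fs ts f : equilibrium fs ts -> flow f ->
  Psi fs <= Psi f + dot (ts - tbar G) (f - fbar G).
Proof.
case=> _ _ max_t min_f flow_f; rewrite -lagrangianE.
apply: le_trans (min_f _ flow_f).
have -> : Psi fs = lagrangian fs (tbar G); last by apply: max_t => e.
by rewrite lagrangianE subrr /dot big1 ?addr0 // => e _; rewrite ffunE mul0r.
Qed.

Definition excess f : {ffun edge G -> R} :=
  [ffun e => Num.max 0 (f e - fbar G e)].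

Lemma excess_ge0 f e : 0 <= excess f e.
Proof. by rewrite ffunE le_max lexx. Qed.

Lemma dot_excess f : dot (excess f) (f - fbar G) = dot (excess f) (excess f).
Proof.
apply: eq_bigr => e _; rewrite !ffunE.
by case: (leP (f e - fbar G e) 0) => [le0 | ?]; rewrite ?mul0r.
Qed.

Lemma min_capacity_le e : 0 < min_capacity G <= fbar G e.
Proof.
have : [set: edge G] != set0 by apply/set0Pn; exists e; rewrite inE.
case/(minvalP 0 _ (fbar G)) => i _ [Emin le_min].
have -> : min_capacity G = fbar G i by exact: Emin.
by rewrite fbar_gt0; apply: le_min; rewrite inE.
Qed.

Lemma max_load_gt1 f : 1 < max_load f ->
  exists e, max_load f - 1 <= excess f e / min_capacity G.
Proof.
(* Without edges [max_load f] is its default 0, against the hypothesis. *)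
have [E0 | E0] := eqVneq [set: edge G] set0.
  rewrite /max_load /maxval; case: pickP => [e | _]; first by rewrite E0 inE.
  by rewrite ltr10.
have [e _ [Emax _]] := maxvalP 0 _ (fun e => f e / fbar G e) E0.
have -> : max_load f = f e / fbar G e by exact: Emax.
move=> gt1; exists e; have /andP[m0 le_m] := min_capacity_le e.
have fe0 := fbar_gt0 e.
have -> : f e / fbar G e - 1 = (f e - fbar G e) / fbar G e.
  by field; rewrite gt_eqF.
apply: (@le_trans _ _ (excess f e / fbar G e)).
  by rewrite ler_pM2r ?invr_gt0 // ffunE le_max lexx orbT.
by rewrite ler_wpM2l ?excess_ge0 // lef_pV2.
Qed.

(** Here q, f and S stand for Q(that), fhat and S_N; the family of bounds over u is all that is used
    of the algorithm. *)
Lemma gap_to_admissible fs ts f g (q eps S : R) :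
  equilibrium fs ts -> flow f -> 0 < slack g -> 0 < S ->
  (forall u, dom_h u ->
     q <= eps / 2 - dot f u + h u + dot (u - tbar G) (u - tbar G) / (2 * S)) ->
  q + Psi (to_admissible g f) <= eps / 2
    + (dot (ts - tbar G) (ts - tbar G)
       + (dot (g - fs) (tbar G) / (slack g * min_capacity G)) ^+ 2) / S.
Proof.
move=> eqs flow_f xi0 S0 bound.
set v := ts - tbar G; set D := dot (g - fs) _; set m := min_capacity G.
set xi := slack g in xi0 *; set p := excess f; set pp := dot p p.
have gap : q + Psi f <= eps / 2 - S / 2 * pp.
  have /bound : dom_h (tbar G + scalev S p).
    by move=> e; rewrite 2!ffunE lerDl mulr_ge0 ?excess_ge0 // ltW.
  have shift : tbar G + scalev S p - tbar G = scalev S p.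
    by rewrite addrAC subrr add0r.
  rewrite /h shift; move: (dot_excess f); rewrite -/p -/pp !dotE.
  rewrite !(dotC p) -/pp -Psi_dot.
  have -> : S * (S * pp) / (2 * S) = S * pp / 2 by field; rewrite gt_eqF.
  move=> Epp; have : S * (dot f p - dot (fbar G) p) = S * pp by rewrite Epp.
  by lra.
rewrite /to_admissible -/xi; set eta := max_load f - 1.
have pp0 : 0 <= S / 2 * pp by rewrite mulr_ge0 ?dot_ge0 ?divr_ge0 ?ltW.
case: (leP eta 0) => [_ | eta0].
  have : 0 <= (dot v v + (D / (xi * m)) ^+ 2) / S.
    by apply: divr_ge0 (ltW S0); rewrite addr_ge0 ?dot_ge0 ?sqr_ge0.
  by lra.
(* The admissible flow is f + th (g - f), and [Psi] is linear. *)
set th := eta / (xi + eta); have xe0 : 0 < xi + eta by rewrite addr_gt0.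
have -> : Psi [ffun e => (xi * f e + eta * g e) / (xi + eta)]
          = Psi f + th * (Psi g - Psi f).
  rewrite /Psi -sumrB mulr_sumr -big_split; apply: eq_bigr => e _ /=.
  by rewrite ffunE /th; field; rewrite gt_eqF.
have [e] : exists e, eta <= p e / m by apply: max_load_gt1; rewrite -subr_gt0.
have /andP[m0 _] := min_capacity_le e; rewrite -/m in m0 * => eta_le.
have pe0 : 0 <= p e := excess_ge0 f e.
have vp0 : 0 <= dot v p.
  apply: sumr_ge0 => i _; rewrite mulr_ge0 ?excess_ge0 //.
  by case: eqs => _ hts _ _; rewrite !ffunE subr_ge0; apply: hts.
have gap_g : Psi g - Psi f <= D + dot v p.
  have := equilibrium_Psi_le _ _ _ eqs flow_f; rewrite -/v.
  have : dot v (f - fbar G) <= dot v p.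
    apply: ler_sum => i _; apply: ler_wpM2l.
      by case: eqs => _ hts _ _; rewrite !ffunE subr_ge0; apply: hts.
    by rewrite !ffunE le_max lexx orbT.
  by rewrite /D dotDl dotNl -!Psi_dot; lra.
have th0 : 0 < th by rewrite divr_gt0.
have th1 : th <= 1 by rewrite ler_pdivrMr // mul1r lerDr ltW.
(* The absolute value avoids a discussion of the sign of [D]; only k^2 enters the final bound. *)
pose k := `|D| / (xi * m).
have k0 : 0 <= k by rewrite divr_ge0 // mulr_ge0 ?ltW.
have thD : th * D <= p e * k.
  apply: le_trans (ler_wpM2l (ltW th0) (ler_norm D)) _.
  have -> : p e * k = p e / m / xi * `|D| by rewrite /k invfM; ring.
  apply: ler_wpM2r => //; rewrite ler_pdivlMr //; apply: le_trans eta_le.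
  by rewrite /th mulrAC ler_pdivrMr // ler_pM2l // lerDl ltW.
have thvp : th * dot v p <= dot v p by rewrite ler_piMl.
(* Two costs are linear in p, namely <v, p> and k p_e. Young's inequality charges S/4 |p|^2 to each,
   which exhausts the available S/2 |p|^2. *)
have := dot_amgm v p (S / 2); rewrite divr_gt0 // -/pp => /(_ isT).
have -> : 2 * (S / 2) = S by field.
have pe_k : p e * k <= k ^+ 2 / S + S / 4 * p e ^+ 2.
  rewrite -subr_ge0.
  have -> : k ^+ 2 / S + S / 4 * p e ^+ 2 - p e * k
            = S * (k / S - p e / 2) ^+ 2 by field; rewrite gt_eqF.
  by rewrite mulr_ge0 ?sqr_ge0 ?ltW.
have pe_pp : p e ^+ 2 <= pp.
  rewrite /pp /dot (bigD1 e) //= -expr2 lerDl; apply: sumr_ge0 => i _.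
  by rewrite -expr2 sqr_ge0.
have S_pe : S / 4 * p e ^+ 2 <= S / 4 * pp by rewrite ler_pM2l ?divr_gt0.
have -> : (D / (xi * m)) ^+ 2 = k ^+ 2.
  by rewrite /k !expr_div_n real_normK ?num_real.
have := ler_wpM2l (ltW th0) gap_g; rewrite mulrDr mulrDl.
by move: gap thD thvp pe_k S_pe; lra.
Qed.

End Duality.

(** * Iteration counts and the two complexity bounds *)

Lemma within_itersI {R : realType} (K : R) (P : nat -> Prop) :
  (forall N, (0 < N)%N -> K <= N%:R -> P N) -> within_iters K P.
Proof.
move=> KP; pose N := absz (Num.max 1 (Num.ceil K)).
have NE : N%:Z = Num.max 1 (Num.ceil K).
  by rewrite gez0_abs // le_max ler01.
have N0 : (0 < N)%N by rewrite -ltz_nat NE lt_max ltr01.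
exists N; split; rewrite ?NE //; apply: KP => //.
apply: le_trans (Num.Theory.ceil_ge K) _.
by rewrite -[N%:R]/(N%:Z%:~R) ler_int NE le_max lexx orbT.
Qed.

Theorem theorem3p2 (R : realType) :
  exists C : R, 0 < C /\
  forall (G : network R) (fstar tstar : {ffun edge G -> R})
    (gradPhi : {ffun edge G -> R} -> {ffun edge G -> R})
    (eps L0 : R) (L : nat -> R) (t : nat -> {ffun edge G -> R}),
  let M := Mconst G in
  let r := norm2 (tstar - tbar G) in
  equilibrium fstar tstar ->
  Mbound G ->
  subgradient_choice gradPhi ->
  0 < eps ->
  0 < L0 <= M ^+ 2 / eps ->
  UGM_run gradPhi eps L0 L t ->
  within_iters (2 * (r * M / eps) ^+ 2)
    (fun N => Q (that L t N) - Q tstar <= eps)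
  /\
  (forall g : {ffun edge G -> R},
   flow g -> 0 < slack g -> 0 < r ->
   within_iters
     (C * ((r * M / eps) ^+ 2 *
           Num.max 1 ((dot (g - fstar) (tbar G) /
                       (slack g * r * min_capacity G)) ^+ 2)))
     (fun N => Q (that L t N) + Psi (to_admissible g (fhat gradPhi L t N))
               <= eps)).
Proof.
(* The constant is 2 * 2 * 2: one factor from [large_S], one from asking for 2 (r^2 + ...) <= eps
   S_N, and one from 1 + K^2 <= 2 max(1, K^2). *)
exists 8; split=> // G fs ts gradPhi eps L0 L t M r eqs MG gradP eps0 L0P run.
have S0 := @Ssum_gt0 _ _ gradPhi eps MG gradP eps0 L0 L t L0P run.
have bound := @Q_that_bound _ _ gradPhi eps MG gradP eps0 L0 L t L0P run.
have flow_f := @flow_fhat _ _ gradPhi eps MG gradP eps0 L0 L t L0P run.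
have large_S := @Ssum_large _ _ gradPhi eps MG gradP eps0 L0 L t L0P run.
have hts : dom_h ts by case: eqs.
have r2 : r ^+ 2 = dot (ts - tbar G) (ts - tbar G) by exact: norm2_sqr.
split=> [|g flow_g xi0 r0]; apply: within_itersI => N N0 KN.
  have := bound N ts N0 hts; have := flow_dot_Phi _ ts (flow_f N N0).
  rewrite -r2 /Q; set f := fhat _ _ _ _.
  suff : r ^+ 2 / (2 * Ssum L N) <= eps / 2 by lra.
  rewrite ler_pdivrMr ?mulr_gt0 ?S0 //.
  suff : r ^+ 2 <= eps * Ssum L N by lra.
  by apply: large_S; rewrite -/M -mulrA -exprMn (mulrA r).
have := gap_to_admissible _ _ _ _ _ _ _ eqs (flow_f N N0) xi0 (S0 N N0)
          (fun u => bound N u N0).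
rewrite -r2; set D := dot _ _; set q := _ + Psi _; move=> gap.
apply: le_trans gap _.
suff : (r ^+ 2 + (D / (slack g * min_capacity G)) ^+ 2) / Ssum L N <= eps / 2.
  by lra.
rewrite ler_pdivrMr ?S0 //.
suff : 2 * (r ^+ 2 + (D / (slack g * min_capacity G)) ^+ 2) <= eps * Ssum L N.
  by lra.
apply: large_S; apply: le_trans KN; rewrite -/M.
have -> : D / (slack g * min_capacity G)
          = r * (D / (slack g * r * min_capacity G)).
  (* With the two inverses as variables, [field] asks only that r be nonzero. *)
  rewrite !invfM; move: (slack g)^-1 (min_capacity G)^-1 => a b.
  by field; rewrite gt_eqF.
move: (D / _) => K; set c := (M / eps) ^+ 2.
have c0 : 0 <= c * r ^+ 2 by rewrite mulr_ge0 ?sqr_ge0.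
have -> : 8 * ((r * M / eps) ^+ 2 * Num.max 1 (K ^+ 2))
          = 8 * (c * r ^+ 2 * Num.max 1 (K ^+ 2))
  by rewrite /c; field; rewrite gt_eqF.
have := ler_wpM2l c0 (_ : 1 <= Num.max 1 (K ^+ 2)).
have := ler_wpM2l c0 (_ : K ^+ 2 <= Num.max 1 (K ^+ 2)).
rewrite !le_max !lexx orbT /= => /(_ isT) + /(_ isT).
by rewrite (exprMn _ r K); lra.
Qed.
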